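(* Let $k\ge 2$ and $0\le l\le k\le n$ be integers. If $T$ is a tree of order $n$ and maximum degree $\Delta\ge 2$, then $\bar{\varepsilon}_{k,l}(T)\le \bar{\varepsilon}_{k,l}(B(n,\Delta))$.
   Context: For a tree $G$ and $S\subseteq V(G)$, $d_G(S)$ is the number of edges of the minimal subtree of $G$ containing $S$. For an $l$-subset $S$ of $V(G)$ ($n=|V(G)|$), $\varepsilon_{k,l}(S;G)=\max\{d_G(S'): S\subseteq S'\subseteq V(G),\ |S'|=k\}$, and $\bar{\varepsilon}_{k,l}(G)=\binom{n}{l}^{-1}\sum_{|S|=l}\varepsilon_{k,l}(S;G)$. The broom $B(n,\Delta)$ is the tree of order $n$ obtained from the star $K_{1,\Delta}$ by identifying one of its leaves with an endpoint of a path on $n-\Delta$ vertices; equivalently, a vertex $c$ with $\Delta-1$ pendant edges and one pendant path of length $n-\Delta$. *)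

(* Defs.v *)
(* MathComp.  A simple graph on a finite vertex type V is a symmetric
   irreflexive relation e : rel V; an edge is the 2-element set of its ends. *)
From HB Require Import structures.
From mathcomp Require Import all_boot all_order all_algebra.

Set Implicit Arguments.
Unset Strict Implicit.
Unset Printing Implicit Defensive.

Section Graphs.
Variable V : finType.
Implicit Types (e : rel V) (W S : {set V}) (F : {set {set V}}).

Definition simple_graph e : Prop := symmetric e /\ irreflexive e.

Definition degree e (x : V) : nat := #|[set y | e x y]|.

Definition max_degree e : nat := \max_(x : V) degree e x.

Definition edges e : {set {set V}} :=
  [set [set p.1; p.2] | p : V * V & e p.1 p.2].

Definition rel_of F : rel V := [rel x y | [set x; y] \in F].

Definition connected_on W e : bool :=
  [forall x in W, forall y in W, connect e x y].

(* A cycle has distinct vertices, hence length at most #|V|; bounding the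
   length makes the predicate boolean (see acyclicP).  The condition 2 < m
   excludes the back-and-forth traversal of an edge. *)
Definition acyclic e : bool :=
  [forall m : 'I_#|V|.+1, forall c : m.-tuple V, (2 < m) ==> ~~ ucycleb e c].

Lemma acyclicP e :
  reflect (forall c : seq V, 2 < size c -> ~ ucycle e c) (acyclic e).
Proof.
apply: (iffP forallP) => [h c c3 /[dup] uc /andP[_ Uc]|h m].
  have lt : size c < #|V|.+1 by rewrite ltnS -(card_uniqP Uc) max_card.
  move/forallP/(_ (in_tuple c)): (h (Ordinal lt)).
  by rewrite /= c3 /= => /negP; apply.
by apply/forallP => c; apply/implyP => m3; apply/negP/h; rewrite size_tuple.
Qed.

(* The graph with vertex set W and adjacency e, where e is only meant to
   relate elements of W. *)
Definition is_tree W e : bool :=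
  [&& W != set0, connected_on W e & acyclic e].

Definition subgraph e (H : {set V} * {set {set V}}) : bool :=
  (H.2 \subset edges e) && [forall f in H.2, f \subset H.1].

Definition subtree e (H : {set V} * {set {set V}}) : bool :=
  subgraph e H && is_tree H.1 (rel_of H.2).

(* The default value, e itself, is a subtree as soon as e is a tree. *)
Definition min_subtree e S : {set V} * {set {set V}} :=
  [arg min_(H < ([set: V], edges e) | subtree e H && (S \subset H.1)) #|H.2|].

Definition steiner e S : nat := #|(min_subtree e S).2|.

Definition ecc e (k : nat) S : nat :=
  \max_(S' : {set V} | (S \subset S') && (#|S'| == k)) steiner e S'.

Definition avg_ecc e (k l : nat) : rat :=
  (('C(#|V|, l)%:R)^-1 * (\sum_(S : {set V} | #|S| == l) ecc e k S)%:R)%R.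

End Graphs.

(* For 0 < D < n: the vertex c is 0, the pendant path of length n - D is
   0, 1, ..., n - D, and the D - 1 remaining vertices are pendant at 0.
   broom_arc contains each edge once, directed away from 0. *)
Definition broom_arc (n D : nat) (i j : 'I_n) : bool :=
  if j <= n - D then j == i.+1 :> nat else i == 0 :> nat.

Definition broom (n D : nat) : rel 'I_n :=
  [rel i j : 'I_n | broom_arc D i j || broom_arc D j i].

(* Main.v *)
Require Import Defs.
From HB Require Import structures.
From mathcomp Require Import all_boot all_order all_algebra.
From mathcomp Require Import zify.

(* Write D for the maximum degree, attained at v, and L = n - D; the leaves of
   the broom are the vertices L, ..., n - 1 and its inner vertices the path
   0, ..., L - 1.

   For l < k there is a bijection under which every single eccentricity of the
   tree is at most that of the broom.  It sends D leaves of the tree to the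
   leaves of the broom.  Each of those leaves that is missed by S' saves an
   edge, and the broom reaches the resulting bound as soon as k >= l + 2 or S
   contains a leaf.  Otherwise k = l + 1 and S lies among the remaining L
   vertices.  These are placed on the path by peeling off two leaves at a time,
   one to each end, so that the vertices at positions j, ..., L - 1 - j span a
   subtree and all vertices are at distance at most j + 1 from it; hence the
   eccentricity is at most L - j if S lies in those positions, which is what
   the broom attains for the largest such j.

   For l = k a single bijection of the vertices need not work, and the sum of
   the Steiner distances is bounded by induction on connected sets W containing
   v and its neighbours, removing a vertex x outside this star.  The sets S
   containing x are compared through a bijection onto the broom with its path
   cut at the same size: D - 1 leaves of W other than x go to the pendant
   vertices, and the other vertices, grown connectedly from x, are laid out
   along the path starting at its end. *)

Set Implicit Arguments.
Unset Strict Implicit.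
Unset Printing Implicit Defensive.

(** * Connected vertex sets *)

Section Connectivity.
Variables (V : finType) (e : rel V).
Hypothesis e_sym : symmetric e.
Implicit Types (A B W Q D S : {set V}) (x y z : V).

(* Connectivity of the subgraph induced on [W], stated through cuts. *)
Definition conn W : Prop :=
  forall A, A \subset W -> A != set0 -> A != W ->
  exists a b, [/\ a \in A, b \in W :\: A & e a b].

(** At most one neighbour in [W]; [y] itself may lie outside [W], as it does in [acyclic_leaf]. *)
Definition leaf W y : Prop :=
  forall a b, a \in W -> b \in W -> e y a -> e y b -> a = b.

Lemma conn1 x : conn [set x].
Proof.
by move=> A; rewrite subset1 => /orP[] /eqP->; rewrite !eqxx.
Qed.

(** As [A] and [B] share [w], every cut [C] of the union restricts to a proper cut of [A] or of
    [B]. *)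
Lemma conn_setU A B : conn A -> conn B -> A :&: B != set0 -> conn (A :|: B).
Proof.
move=> cA cB /set0Pn[w /setIP[wA wB]] C sC nC CN.
case: (boolP (A :&: C == set0)) => [|nAC].
  move=> AC0; have sCB : C \subset B.
    apply/subsetP => c cC; move/subsetP/(_ c cC): sC;
      rewrite inE => /orP[cA'|//].
    by move/eqP/setP/(_ c): AC0; rewrite !inE cA' cC.
  have CB : C != B.
    apply: contraL AC0 => /eqP->; apply/set0Pn; exists w; by rewrite inE wA wB.
  have [a [b [aC /setDP[bB bC] eab]]] := cB C sCB nC CB.
  by exists a, b; split => //; rewrite !inE bC bB orbT.
case: (boolP (A :&: C == A)) => [/eqP AC|AC]; last first.
  have [a [b [/setIP[aA aC] /setDP[bA]]]] := cA _ (subsetIl A C) nAC AC.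
  rewrite inE bA /= => bC eab.
  by exists a, b; split => //; rewrite !inE bC bA.
have sAC : A \subset C by rewrite -AC subsetIr.
case: (boolP (B :&: C == B)) => [/eqP BC|BC].
  have sBC : B \subset C by rewrite -BC subsetIr.
  by case/eqP: CN; apply/eqP; rewrite eqEsubset sC subUset sAC sBC.
have nBC : B :&: C != set0.
  by apply/set0Pn; exists w; rewrite inE wB (subsetP sAC).
have [a [b [/setIP[aA aC] /setDP[bA]]]] := cB _ (subsetIl B C) nBC BC.
rewrite inE bA /= => bC eab.
by exists a, b; split => //; rewrite !inE bC bA orbT.
Qed.

Lemma conn2 x y : e x y -> conn [set x; y].
Proof.
move=> exy A sA nA AN.
have mem a : a \in A -> a = x \/ a = y.
  by move/(subsetP sA); rewrite !inE => /orP[]/eqP; [left|right].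
case/set0Pn: nA => a aA.
have [xA|xA] := boolP (x \in A); have [yA|yA] := boolP (y \in A).
- case/eqP: AN; apply/setP => b; rewrite !inE.
  by apply/idP/orP => [/mem[]->|[]/eqP->]; rewrite ?eqxx; auto.
- by exists x, y; rewrite !inE yA eqxx orbT.
- by exists y, x; rewrite !inE xA eqxx e_sym.
- by case: (mem _ aA) => ax; rewrite -ax aA in xA yA.
Qed.

Lemma conn_add W x y : conn W -> x \in W -> e x y -> conn (y |: W).
Proof.
move=> cW xW exy; have := conn_setU (conn2 exy) cW.
have -> : [set x; y] :|: W = y |: W.
  by apply/setP => z; rewrite !inE; case: eqP => [->|_]; rewrite ?xW ?orbT.
by apply; apply/set0Pn; exists x; rewrite !inE eqxx.
Qed.

Lemma conn_star W x : x \in W -> (forall y, y \in W -> y != x -> e x y) ->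
  conn W.
Proof.
move=> xW h A sA nA AN.
have [xA|xA] := boolP (x \in A).
  have : ~~ (W \subset A) by apply: contra AN => ?; rewrite eqEsubset sA.
  case/subsetPn => b bW bA; exists x, b; split => //; first by rewrite inE bA.
  by apply: h => //; apply: contraNneq bA => ->.
case/set0Pn: nA => a aA; exists a, x; split => //; first by rewrite inE xA.
by rewrite e_sym h ?(subsetP sA) //; apply: contraNneq xA => <-.
Qed.

(** A cut [A] of [W :\: F] is enlarged to [A'] by the vertices of [F] attached to it. An edge
    leaving [A'] cannot start in [F], where the only neighbour is already in [A], and cannot end in
    [F], since its end would belong to [A']. *)
Lemma conn_leaves W (F : {set V}) : conn W ->
  (forall y, y \in F -> leaf W y) -> conn (W :\: F).
Proof.
move=> cW lF A sA nA AN.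
pose A' := A :|: [set y in W :&: F | [exists a in A, e y a]].
have sAW a : a \in A -> (a \in W) /\ (a \notin F).
  by move/(subsetP sA); rewrite inE => /andP[].
case: (cW A').
- apply/subsetP => a; rewrite !inE => /orP[/sAW[]//|/andP[/andP[]//]].
- by case/set0Pn: nA => a aA; apply/set0Pn; exists a; rewrite !inE aA.
- apply: contra AN => /eqP A'W; rewrite eqEsubset sA /=; apply/subsetP => b.
  by rewrite !inE -A'W !inE => /andP[/negPf->]; rewrite andbF orbF.
move=> a [b [+ /setDP[bW]]]; rewrite !inE bW /= negb_or.
move=> aA' /andP[bA] bE eab.
have bF : b \in F -> a \notin A.
  move=> bF; apply: contra bE => aA; rewrite bF; apply/existsP; exists a.
  by rewrite aA e_sym.
case/orP: aA' => [aA|/andP[/andP[aW aF] /existsP[c /andP[cA eac]]]].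
  by exists a, b; split => //; rewrite !inE bW bA (contraL bF aA).
have [cW' _] := sAW _ cA.
by rewrite -(lF _ aF _ _ cW' bW eac eab) cA in bA.
Qed.

(** Grow [A] by adjacent vertices, one at a time, until [W] is reached; the last vertex added is the
    one to remove. *)
Lemma conn_remove A W : conn A -> conn W -> A != set0 -> A \proper W ->
  exists2 x, x \in W :\: A & conn (W :\ x).
Proof.
have [m] := ubnP (#|W| - #|A|); elim: m A => // m IHm A + cA cW nA pA.
have := proper_card pA; case/andP: (pA) => sA nWA.
have AW : A != W by apply: contraNneq nWA => ->.
have [a [b [aA /setDP[bW bA] eab]]] := cW A sA nA AW.
have cbA := conn_add cA aA eab.
have sbA : b |: A \subset W by rewrite subUset sub1set bW.
case: (eqVneq (b |: A) W) => [bAW _ _|nbAW].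
  by exists b; rewrite ?inE ?bA // -bAW setU1K.
move=> lt1 lt2; have [|||x] := IHm (b |: A) _ cbA cW.
- by rewrite cardsU1 bA; move: lt1 lt2; clear; lia.
- by apply/set0Pn; exists b; rewrite !inE eqxx.
- by rewrite properEneq nbAW.
by move=> /setDP[xW]; rewrite !inE negb_or => /andP[_ xA] cx; exists x;
  rewrite // inE xA.
Qed.

Lemma conn_nbr W y : conn W -> y \in W -> 1 < #|W| ->
  exists2 p, p \in W :\ y & e y p.
Proof.
move=> cW yW W1; case: (cW [set y]).
- by rewrite sub1set.
- by apply/set0Pn; exists y; rewrite inE.
- by apply: contraTneq W1 => <-; rewrite cards1.
by move=> a [b [/set1P-> bW eyb]]; exists b.
Qed.

(** Repeatedly take away a vertex other than [x] that leaves the rest connected, so that [x] comes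
    last. For [m] beyond the end the suffix is empty and the claim is vacuous. *)
Lemma grow_order W x : conn W -> x \in W ->
  exists s, [/\ uniq s, s =i W, nth x s (size s).-1 = x &
    forall m, conn [set y in drop m s]].
Proof.
have [m] := ubnP #|W|; elim: m W => // m IHm W Wm cW xW.
case: (boolP ([set x] \proper W)) => [pW|]; last first.
  rewrite properEneq sub1set xW andbT negbK => /eqP <-.
  exists [:: x]; split => // [y|[|k]]; rewrite ?inE //=.
    have -> : [set y in [:: x]] = [set x] by apply/setP => y; rewrite !inE.
    exact: conn1.
  by move=> A sA nA; case/set0Pn: nA => a /(subsetP sA); rewrite inE.
have n1 : [set x] != set0 by apply/set0Pn; exists x; rewrite inE.
have [y] := conn_remove (@conn1 x) cW n1 pW.
rewrite !inE => /andP[yx yW] cWy.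
have [||s [us sW lasts cs]] := IHm _ _ cWy.
- by move: Wm; rewrite (cardsD1 y W) yW.
- by rewrite !inE eq_sym yx.
exists (y :: s); split.
- by rewrite /= us sW !inE eqxx.
- move=> z; rewrite inE sW !inE; case: eqVneq => [->|//]; by rewrite yW.
- have : x \in s by rewrite sW !inE eq_sym yx.
  by case: (s) lasts.
case=> [|k] /=; last exact: cs.
have -> // : [set z in y :: s] = W.
by apply/setP => z; rewrite !inE sW !inE; case: eqVneq => [->|//]; rewrite yW.
Qed.

End Connectivity.

(** * Steiner distance in a tree *)

Section Steiner.
Variables (V : finType) (e : rel V).
Implicit Types (S : {set V}) (H : {set V} * {set {set V}}).

Lemma mem_edges x y : symmetric e -> ([set x; y] \in edges e) = e x y.
Proof.
move=> es; apply/imsetP/idP => [[[a b] eab /= xyE]|exy]; last first.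
  by exists (x, y); rewrite ?inE.
rewrite inE /= in eab.
have : a \in [set x; y] by rewrite xyE !inE eqxx.
have : b \in [set x; y] by rewrite xyE !inE eqxx orbT.
have : x \in [set a; b] by rewrite -xyE !inE eqxx.
have : y \in [set a; b] by rewrite -xyE !inE eqxx orbT.
rewrite !inE.
by do 4![case/orP=> /eqP ?]; subst=> //; rewrite es.
Qed.

(** [H] itself witnesses that a minimiser exists, so the minimum does not fall to its default
    value. *)
Lemma steiner_minP S H : subtree e H -> S \subset H.1 -> steiner e S <= #|H.2|.
Proof.
move=> tH sH; rewrite /steiner /min_subtree /arg_min /extremum.
case: pickP => [H' /andP[_ /forallP/(_ H)]|noH] /=; first by rewrite tH sH.
pose P H := subtree e H && (S \subset H.1).
have PH : P H by rewrite /P tH.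
case: (arg_minnP (fun H : {set V} * {set {set V}} => #|H.2|) PH) =>
  H' PH' minH'.
have /andP[] := noH H'; split => //; apply/forallP => H''.
by apply/implyP; apply: minH'.
Qed.

(** The bound on [edges e] covers the default value of the minimum, which is the whole graph. *)
Lemma steiner_ge m S : m <= #|edges e| ->
  (forall H, subtree e H -> S \subset H.1 -> m <= #|H.2|) -> m <= steiner e S.
Proof.
move=> m_le h; rewrite /steiner /min_subtree /arg_min /extremum.
by case: pickP => [H' /andP[/andP[tH sH] _]|] //=; apply: h.
Qed.

End Steiner.

Section Tree.
Variables (V : finType) (e : rel V).
Hypotheses (e_sym : symmetric e) (e_irr : irreflexive e) (e_acyc : acyclic e).
Implicit Types (W Q D S : {set V}).

Lemma conn_connect W a b : conn e W -> a \in W -> b \in W ->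
  connect [rel x y | [&& x \in W, y \in W & e x y]] a b.
Proof.
set r := [rel x y | _] => cW aW bW.
pose A := [set x in W | connect r a x].
case: (eqVneq A W) => [AW|AN]; first by move: bW; rewrite -AW inE => /andP[].
have sA : A \subset W by apply/subsetP => x; rewrite inE => /andP[].
have nA : A != set0 by apply/set0Pn; exists a; rewrite inE aW connect0.
have [x [y [+ /setDP[yW]]]] := cW A sA nA AN.
rewrite !inE yW /= => /andP[xW ax] /negP nay exy; case: nay.
by apply: connect_trans ax (connect1 _); rewrite /= xW yW.
Qed.

(** Two distinct neighbours of [x] in [W] are joined by a path inside [W], which [x] closes to a
    cycle. *)
Lemma acyclic_leaf W x : conn e W -> x \notin W -> leaf e W x.
Proof.
move=> cW xW a b aW bW exa exb; apply/eqP/contraT => ab.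
case/connectP: (conn_connect cW aW bW) => p0 pth0 lst0.
case: (shortenP pth0) lst0 => p pth up _ lst.
have pW : all (mem W) (a :: p).
  rewrite /= aW /=; elim: p a aW pth {up lst exa ab pth0 exb} =>
    //= c p IH a aW.
  by case/andP=> /and3P[_ cW' _] /IH->; rewrite ?cW'.
have p3 : 2 < size (x :: a :: p) by case: p lst ab {pth up pW} => //= ->;
  rewrite eqxx.
case: (elimT (acyclicP e) e_acyc _ p3); apply/andP; split => /=; last first.
  by rewrite -/(uniq (a :: p)) up andbT; apply: contra xW => /(allP pW).
rewrite exa rcons_path -lst e_sym exb andbT /=.
by apply: sub_path pth => u w /and3P[].
Qed.

(** [W] has a spanning tree with [#|W|.-1] edges: add back a removable vertex [y] by one edge to a
    neighbour [p]. Acyclicity is inherited from [e], so the induction only tracks connectivity and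
    size. *)
Lemma steiner_le W S : conn e W -> W != set0 -> S \subset W ->
  steiner e S <= #|W|.-1.
Proof.
move=> cW nW sSW.
suff [F [sF sFW cF cardF]] : exists F : {set {set V}}, [/\ F \subset edges e,
    [forall f in F, f \subset W], connected_on W (rel_of F) & #|F| <= #|W|.-1].
  apply: leq_trans cardF; apply: (steiner_minP (H := (W, F))) => //.
  rewrite /subtree /subgraph /is_tree /= sF sFW nW cF /=.
  apply/acyclicP => c c3 /andP[cyc uc].
  case: (elimT (acyclicP e) e_acyc _ c3); apply/andP; split => //.
  apply: sub_cycle cyc => x y xyF.
  by rewrite -(mem_edges _ _ e_sym); apply: (subsetP sF).
have [m] := ubnP #|W|; elim: m W cW nW {sSW} => // m IHm W cW nW Wm.
case/set0Pn: nW => x xW.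
case: (boolP ([set x] \proper W)) => [pW|]; last first.
  rewrite properEneq sub1set xW andbT negbK => /eqP <-.
  exists set0; split; rewrite ?sub0set ?cards0 //.
    by apply/forall_inP => f; rewrite inE.
  by apply/forall_inP => a /set1P->; apply/forall_inP => b /set1P->;
    apply: connect0.
have n1 : [set x] != set0 by apply/set0Pn; exists x; rewrite inE.
have [y] := conn_remove e_sym (@conn1 _ e x) cW n1 pW.
rewrite !inE => /andP[yx yW] cWy.
have cardW : #|W| = #|W :\ y|.+1 by rewrite (cardsD1 y W) yW.
have xWy : x \in W :\ y by rewrite !inE eq_sym yx.
have [||F [sF sFW cF cardF]] := IHm _ cWy.
- by apply/set0Pn; exists x.
- by rewrite -ltnS -cardW.
have W1 : 1 < #|W| by have := proper_card pW; rewrite cards1.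
have [p pWy eyp] := conn_nbr cW yW W1.
exists ([set y; p] |: F); split.
- by rewrite subUset sub1set mem_edges // eyp.
- apply/forall_inP => f /setU1P[->|fF].
    by rewrite subUset !sub1set yW; case/setD1P: pWy.
  by apply: subset_trans (subsetDl W [set y]); apply: (forall_inP sFW).
- have sub : subrel (connect (rel_of F)) (connect (rel_of ([set y; p] |: F))).
    apply: connect_sub => a b ab; apply: connect1.
    by rewrite /rel_of /= in ab *; rewrite !inE ab orbT.
  have cs : connect_sym (rel_of ([set y; p] |: F)).
    by apply: sym_connect_sym => a b; rewrite /rel_of /= setUC.
  have yp : connect (rel_of ([set y; p] |: F)) y p.
    by apply: connect1; rewrite /rel_of /= !inE eqxx.
  have top b : b \in W -> connect (rel_of ([set y; p] |: F)) p b.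
    move=> bW; case: (eqVneq b y) => [->|by']; first by rewrite cs.
    apply: sub; apply: (forall_inP (forall_inP cF _ pWy)).
    by rewrite !inE by'.
  apply/forall_inP => a aW; apply/forall_inP => b bW.
  by apply: connect_trans (top _ bW); rewrite cs; apply: top.
- rewrite cardsU1; move: cardF; rewrite cardW /=.
  have : 0 < #|W :\ y| by apply/card_gt0P; exists x.
  case: (_ \notin _); case: #|W :\ y| => //= n' _; rewrite ?add1n ?add0n //.
  exact: leqW.
Qed.

Lemma conn_tree : is_tree [set: V] e -> conn e [set: V].
Proof.
case/and3P=> _ /forall_inP h _ A _ /set0Pn[a aA] AN.
have : ~~ ([set: V] \subset A) by apply: contra AN => ?;
  rewrite eqEsubset subsetT.
case/subsetPn => b _ bA.
case: (boolP [exists x in A, exists y, (y \notin A) && e x y]) => [|no].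
  case/exists_inP=> x xA /existsP[y /andP[yA exy]].
  by exists x, y; split => //; rewrite !inE yA.
have cl : closed e (mem A).
  apply: (intro_closed (sym_connect_sym e_sym)) => x y exy xA.
  apply: contraR no => yA; apply/exists_inP; exists x => //.
  by apply/existsP; exists y; rewrite yA.
have ab := closed_connect cl (forall_inP (h a (in_setT a)) b (in_setT b)).
by move: bA; rewrite -[b \in A]ab aA.
Qed.

End Tree.

(** * Leaves of a tree and orders that peel them off *)

Section TreeOrders.
Variables (V : finType) (e : rel V).
Hypotheses (e_sym : symmetric e) (e_irr : irreflexive e) (e_acyc : acyclic e).
Implicit Types (W Q D S L : {set V}).

Lemma removable_leaf W x : conn e (W :\ x) -> leaf e W x.
Proof.
move=> cW a b aW bW exa exb.
have ne c : e x c -> c != x by apply: contraTneq => ->; rewrite e_irr.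
have xW : x \notin W :\ x by rewrite !inE eqxx.
by apply: (acyclic_leaf e_sym e_acyc cW xW) => //; rewrite !inE ?ne.
Qed.

(** Induction on [W] down to the star of [v], whose leaves are the neighbours of [v]; the vertex [x]
    removed lies outside the star and is a leaf of [W]. *)
Lemma exists_leaves W v : conn e W -> v \in W -> [set y | e v y] \subset W ->
  0 < degree e v ->
  exists L, [/\ L \subset W :\ v, #|L| = degree e v &
    forall y, y \in L -> leaf e W y].
Proof.
move=> + + + deg_gt0.
have [m] := ubnP #|W|; elim: m W => // m IHm W Wm cW vW nvW.
pose A := v |: [set y | e v y].
have star (B : {set V}) : v \in B -> B \subset A -> conn e B.
  move=> vB sBA; apply: (conn_star e_sym vB) => y /(subsetP sBA).
  by rewrite !inE => /orP[->|].
have sAW : A \subset W by rewrite subUset sub1set vW.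
have [pA|] := boolP (A \proper W); last first.
  rewrite properEneq sAW andbT negbK => /eqP AW.
  exists [set y | e v y]; split => // [|y].
    rewrite -AW; apply/subsetP => y; rewrite !inE => evy;
      rewrite evy orbT andbT.
    by apply: contraTneq evy => ->; rewrite e_irr.
  rewrite inE => evy; apply: removable_leaf; apply: star;
    last by rewrite -AW subsetDl.
  by rewrite !inE vW andbT; apply: contraTneq evy => ->; rewrite e_irr.
have nA : A != set0 by apply/set0Pn; exists v; rewrite !inE eqxx.
have cA : conn e A by apply: star; rewrite ?inE ?eqxx.
have [x /setDP[xW]] := conn_remove e_sym cA cW nA pA.
rewrite !inE negb_or => /andP[xv nevx] cWx.
have cardW : #|W| = #|W :\ x|.+1 by rewrite (cardsD1 x W) xW.
have [|||L [sL cardL leafL]] := IHm (W :\ x) _ cWx.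
- by rewrite -ltnS -cardW.
- by rewrite !inE eq_sym xv.
- apply/subsetP => y yN; rewrite !inE (subsetP nvW) // andbT.
  by apply: contraNneq nevx => <-; move: yN; rewrite inE.
have W1 : 1 < #|W|.
  by rewrite cardW ltnS; apply/card_gt0P; exists v; rewrite !inE eq_sym xv.
have [p pW exp] := conn_nbr cW xW W1.
(* Putting [x] back gives only [p] a new neighbour. So [x] takes the place of [p] if [p] was a
   chosen leaf, and of an arbitrary chosen leaf otherwise, which keeps the number. *)
have [q qL pq] : exists2 q, q \in L & p \in L -> q = p.
  have [pL|pL] := boolP (p \in L); first by exists p.
  have /card_gt0P[q qL] : 0 < #|L| by rewrite cardL.
  by exists q.
have lx := removable_leaf cWx.
have xL : x \notin L by apply: contraTN isT => /(subsetP sL);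
  rewrite !inE eqxx andbF.
exists (x |: L :\ q); split.
- rewrite subUset sub1set !inE xv xW /=.
  apply: subset_trans (subsetDl _ _) (subset_trans sL _).
  by apply: setSD; apply: subsetDl.
- by rewrite cardsU1 !inE (negPf xL) andbF -cardL (cardsD1 q L) qL.
move=> y; rewrite !inE => /orP[/eqP-> //|/andP[yq yL]].
have yx : ~~ e y x.
  apply/negP; rewrite e_sym => exy.
  have yW : y \in W by have := subsetP sL _ yL; rewrite !inE => /and3P[].
  have pW' : p \in W by have := pW; rewrite inE => /andP[].
  have yp := lx _ _ yW pW' exy exp.
  by case/eqP: yq; rewrite yp pq // -yp.
move=> a b aW bW ea eb; apply: (leafL y yL) => //; rewrite !inE ?aW ?bW andbT.
  by apply: contraNneq yx => <-.
by apply: contraNneq yx => <-.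
Qed.

(** Both vertices are removable one at a time, hence leaves, and leaves can be removed together. *)
Lemma conn_remove2 Q : conn e Q -> 2 < #|Q| ->
  exists y z, [/\ y \in Q, z \in Q, z != y &
    [/\ conn e (Q :\ y), conn e (Q :\ z) & conn e (Q :\ y :\ z)]].
Proof.
move=> cQ Q2; have [x xQ] : exists x, x \in Q by apply/card_gt0P;
  apply: leq_trans Q2.
have rem w : w \in Q -> exists2 y, y \in Q :\ w & conn e (Q :\ y).
  move=> wQ; apply: (conn_remove e_sym (@conn1 _ e w) cQ).
    by apply/set0Pn; exists w; rewrite inE.
  rewrite properEneq sub1set wQ andbT; apply: contraTneq Q2 => <-.
  by rewrite cards1.
have [y /setD1P[_ yQ] cy] := rem x xQ.
have [z /setD1P[zy zQ] cz] := rem y yQ.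
exists y, z; split => //; split => //.
rewrite setDDl; apply: (conn_leaves e_sym cQ) => w.
by rewrite !inE => /orP[/eqP->|/eqP->]; apply: removable_leaf.
Qed.

Definition window (s : seq V) j := [set x in drop j (take (size s - j) s)].

(* Obtained by repeatedly peeling off two leaves, one to each end of [s]. *)
Lemma peel_order Q : conn e Q ->
  exists s, [/\ uniq s, s =i Q & forall j, j.*2 < size s ->
    conn e (window s j) /\
    forall x, x \in Q -> exists D, [/\ conn e D, x \in D,
      D :&: window s j != set0 & #|D| <= j.+1]].
Proof.
have [m] := ubnP #|Q|; elim: m Q => // m IHm Q Qm cQ.
have base s : s =i Q -> conn e (window s 0) /\
    forall x, x \in Q -> exists D, [/\ conn e D, x \in D,
      D :&: window s 0 != set0 & #|D| <= 1].
  move=> sQ; have -> : window s 0 = Q.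
    by apply/setP => x; rewrite inE drop0 subn0 take_size sQ.
  split => // x xQ; exists [set x]; split; rewrite ?cards1 ?inE //.
    exact: conn1.
  by apply/set0Pn; exists x; rewrite !inE eqxx.
case: (leqP #|Q| 2) => [Q2|Q3].
  exists (enum Q); split; [exact: enum_uniq | exact: mem_enum |].
  case=> [_|j]; first by apply: base; apply: mem_enum.
  by rewrite -cardE doubleS => h; have := leq_trans h Q2.
have [y [z [yQ zQ zy [cy cz cyz]]]] := conn_remove2 cQ Q3.
have cardQ : #|Q| = #|Q :\ y :\ z|.+2.
  by rewrite (cardsD1 y) yQ (cardsD1 z) !inE zy zQ.
have [|s [us sQ ws]] := IHm _ _ cyz; first by move: Qm; rewrite cardQ ltnS;
  apply: ltnW.
have sE : y :: rcons s z =i Q.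
  move=> w; rewrite inE mem_rcons inE sQ !inE.
  by case: (eqVneq w y) => [->|_]; first (by rewrite yQ);
    case: (eqVneq w z) => [->|_]; rewrite ?yQ ?zQ.
exists (y :: rcons s z); split => //.
  by rewrite /= rcons_uniq mem_rcons inE !sQ !inE !eqxx andbF orbF eq_sym zy.
case=> [_|j]; first exact: base.
rewrite /= size_rcons doubleS !ltnS => js.
have -> : window (y :: rcons s z) j.+1 = window s j.
  rewrite /window /= size_rcons subSS subSn; last by move: js; clear; lia.
  by rewrite /= -cats1 takel_cat // leq_subr.
have [cw dw] := ws j js; split => // x xQ.
(* The ends [y] and [z] reach the window through a neighbour [w] in the inner set, at the cost of
   one more vertex. This [w] exists because [Q :\ z] and [Q :\ y] are connected. *)
have extend w : w \in Q :\ y :\ z -> e x w ->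
    exists D, [/\ conn e D, x \in D, D :&: window s j != set0 & #|D| <= j.+2].
  move=> wQ exw; have [D [cD wD nD cardD]] := dw w wQ; exists (x |: D); split.
  - by apply: conn_add wD _ => //; rewrite e_sym.
  - by rewrite !inE eqxx.
  - by apply: contraNN nD; rewrite -!subset0 => /(subset_trans _); apply;
    apply/setSI/subsetUr.
  - by rewrite cardsU1; case: (_ \notin _); rewrite ?add1n ?add0n // ltnW.
have cardy : 1 < #|Q :\ y| by move: Q3; rewrite (cardsD1 y) yQ.
have cardz : 1 < #|Q :\ z| by move: Q3; rewrite (cardsD1 z) zQ.
case: (eqVneq x y) => [xy|xy].
  have xQz : x \in Q :\ z by rewrite !inE xQ xy eq_sym zy.
  have [w wQ exw] := conn_nbr cz xQz cardz; apply: (extend w) => //.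
  by move: wQ; rewrite xy !setDDl setUC.
case: (eqVneq x z) => [xz|xz].
  have xQy : x \in Q :\ y by rewrite !inE xQ xy.
  have [w wQ exw] := conn_nbr cy xQy cardy; apply: (extend w) => //.
  by rewrite -xz.
have [|D [cD xD nD cardD]] := dw x; first by rewrite !inE xz xy.
by exists D; split => //; apply: ltnW.
Qed.

End TreeOrders.

(** * Lower bounds for the broom *)

Lemma exists_set_between (T : finType) (A B : {set T}) k :
  A \subset B -> #|A| <= k <= #|B| ->
  exists C : {set T}, [/\ A \subset C, C \subset B & #|C| = k].
Proof.
move=> sAB /andP[Ak kB].
pose X := [set x in take (k - #|A|) (enum (B :\: A))].
have sX x : x \in X -> x \in B :\: A.
  by rewrite inE => /mem_take; rewrite mem_enum.
have cardX : #|X| = k - #|A|.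
  rewrite cardsE (card_uniqP _) ?take_uniq ?enum_uniq // size_takel // -cardE.
  by rewrite cardsD (setIidPr sAB) leq_sub2r.
exists (A :|: X); split; first exact: subsetUl.
  by rewrite subUset sAB; apply/subsetP => x /sX /setDP[].
rewrite cardsU cardX (_ : A :&: X = set0) ?cards0 ?subn0 ?subnKC //.
apply/setP => x; rewrite in_setI in_set0; apply/negP => /andP[xA /sX].
by rewrite inE xA.
Qed.

Lemma card_ord_interval n a b : b <= n ->
  #|[set i : 'I_n | a <= i < b]| = b - a.
Proof.
move=> bn; rewrite -[b in RHS](minn_idPl bn) {bn} -sum1dep_card big_mkcond /=.
elim: n => [|n IHn]; first by rewrite big_ord0; lia.
by rewrite big_ord_recr /= IHn; case: ifP; lia.
Qed.

Section EccBounds.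
Variables (V : finType) (e : rel V).

Lemma ecc_ge k (S S' : {set V}) : S \subset S' -> #|S'| = k ->
  steiner e S' <= ecc e k S.
Proof.
by move=> sS cS; rewrite /ecc (bigmax_sup S') // sS cS eqxx.
Qed.

Lemma ecc_le k (S : {set V}) m :
  (forall S' : {set V}, S \subset S' -> #|S'| = k -> steiner e S' <= m) ->
    ecc e k S <= m.
Proof. by move=> h; apply/bigmax_leqP => S' /andP[sS /eqP]; apply: h. Qed.

Lemma ecc_card (S : {set V}) : ecc e #|S| S = steiner e S.
Proof.
apply/eqP; rewrite eqn_leq ecc_ge // andbT; apply: ecc_le => S' sS cS.
by have /eqP-> // : S == S'; rewrite eqEcard sS cS /=.
Qed.

End EccBounds.

Section Broom.
Variables n D : nat.
Hypotheses (D2 : 2 <= D) (Dn : D < n).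
Implicit Types (S J : {set 'I_n}) (i j x : 'I_n).

Let L := n - D.

(** For [0 < i], the descendants of [i], itself included, when the broom is rooted at 0. *)
Definition below i x := if i <= L then i <= x <= L else x == i.

Definition parent i : 'I_n := insubd i (if i <= L then i.-1 else 0).

Lemma val_parent i : parent i = (if i <= L then i.-1 else 0) :> nat.
Proof. by rewrite val_insubd; have := ltn_ord i; case: ifP; case: ifP; lia. Qed.

Lemma broom_sym : symmetric (@broom n D).
Proof. by move=> i j; rewrite /broom /= orbC. Qed.

Lemma broom_parent i : 0 < i -> broom D i (parent i).
Proof.
move=> i0; rewrite /broom /= /broom_arc val_parent -/L.
by apply/orP; right; case: (leqP i L) => iL; lia.
Qed.

Lemma broom_cut i x y : 0 < i -> broom D x y -> below i x -> ~~ below i y ->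
  x = i /\ y = parent i.
Proof.
move=> i0; rewrite /broom /= /broom_arc /below -/L => xy ix iy.
suff [xi yi] : x = i :> nat /\ y = (if i <= L then i.-1 else 0) :> nat.
  by split; apply: val_inj; rewrite //= ?val_parent.
move: xy ix iy; rewrite -!val_eqE /= -/L; move: L (val i) (val x) (val y) i0.
clear=> L i x y; case: (leqP i L); case: (leqP x L); case: (leqP y L); lia.
Qed.

(** The edge from [i] to [parent i] is the only one leaving [below i], so it lies in every subtree
    containing [S]. Distinct [i] give distinct edges, as [parent i < i]. *)
Lemma broom_steiner_ge S J :
  (forall i, i \in J -> 0 < i /\ exists a b, [/\ a \in S, b \in S, below i a &
    ~~ below i b]) -> #|J| <= steiner (@broom n D) S.
Proof.
move=> hJ; pose f i := [set i; parent i].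
have lt_parent i : 0 < i -> parent i < i.
  by move=> i0; rewrite val_parent; case: ifP; lia.
have <- : #|f @: J| = #|J|.
  apply: card_in_imset => i j /hJ[i0 _] /hJ[j0 _] fij.
  have : i \in f j by rewrite -fij !inE eqxx.
  have : j \in f i by rewrite fij !inE eqxx.
  rewrite !inE => /orP[/eqP-> //|/eqP jp] /orP[/eqP-> //|/eqP ip].
  by have := lt_parent i i0; have := lt_parent j j0; rewrite -ip -jp; lia.
apply: steiner_ge => [|H tH sSH];
  apply/subset_leq_card/subsetP => _ /imsetP[i iJ ->].
  by rewrite mem_edges ?broom_parent //; [case: (hJ i iJ) | exact: broom_sym].
case: (hJ i iJ) => i0 [a [b [aS bS ia ib]]].
case/and4P: tH => /andP[sH _] _ /forall_inP cH _.
have := forall_inP (cH a (subsetP sSH a aS)) b (subsetP sSH b bS).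
have rs : symmetric (rel_of H.2) by move=> x y; rewrite /rel_of /= setUC.
case: (boolP [exists x, exists y, [&& rel_of H.2 x y,
  below i x & ~~ below i y]]).
  case/existsP=> x /existsP[y /and3P[xy ix iy]] _.
  have bxy : broom D x y.
    by rewrite -(mem_edges _ _ broom_sym); apply: (subsetP sH).
  by case: (broom_cut i0 bxy ix iy) xy => -> ->.
move=> no cab.
have cl : closed (rel_of H.2) [pred x | below i x].
  apply: (intro_closed (sym_connect_sym rs)) => x y xy ix.
  apply: contraR no => iy; apply/existsP; exists x; apply/existsP; exists y.
  by rewrite !inE in ix iy; rewrite xy ix.
by move: (closed_connect cl cab); rewrite !inE ia (negPf ib).
Qed.

(** The vertex [x] is separated from [j] by each path edge above [m.+1], ..., [j], and every pendant
    vertex in [S] requires its own edge. *)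
Lemma broom_steiner_path S j x m : j \in S -> j <= L -> x \in S ->
  (x <= m) || (L < x) ->
  j - m + #|[set i in S | L < i]| <= steiner (@broom n D) S.
Proof.
move=> jS jL xS xm.
pose I := [set i : 'I_n | m < i < j.+1].
have <- : #|I :|: [set i in S | L < i]| = j - m + #|[set i in S | L < i]|.
  rewrite cardsU card_ord_interval ?ltn_ord // subSS [_ :&: _](_ : _ = set0)
    ?cards0 ?subn0 //.
  by apply/setP => i; rewrite !inE; case: (i \in S); rewrite ?andbF //; lia.
apply: broom_steiner_ge => i; rewrite !inE => /orP[ij|/andP[iS iL]]; split;
  try lia.
  by exists j, x; split => //; rewrite /below ifT; move: xm; lia.
exists i, j; split => //; rewrite /below leqNgt iL //= -val_eqE /=; lia.
Qed.

Lemma broom_steiner_star S : 1 < #|S| -> (forall i,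
  i \in S -> (i <= 1) || (L < i)) ->
  #|[set i in S | 0 < i]| <= steiner (@broom n D) S.
Proof.
move=> S1 sS; apply: broom_steiner_ge => i; rewrite inE => /andP[iS i0];
  split => //.
have /card_gt0P[b] : 0 < #|S :\ i| by move: S1; rewrite (cardsD1 i) iS.
rewrite !inE => /andP[bi bS]; exists i, b; split => //.
  by rewrite /below; case: ifP; rewrite ?eqxx // leqnn.
have := sS i iS; have := sS b bS; move: bi; rewrite /below -val_eqE /=.
by case: ifP => //; lia.
Qed.

(** Choose [S'] to contain the path's end [L], a pendant vertex and as many of the [D] leaves as
    possible. The whole path gives [L] edges, and each leaf other than [L] gives one, hence the
    successor on the right. *)
Lemma broom_ecc_ge_leaves k S : #|S| < k <= n ->
  (0 < #|[set i in S | L <= i]|) || (#|S|.+1 < k) ->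
  L + minn D (#|[set i in S | L <= i]| + (k - #|S|)) <= (ecc (@broom n D) k
    S).+1.
Proof.
move=> /andP[Sk kn] big; pose B := [set i : 'I_n | L <= i].
have Ln : L.+1 < n by rewrite /L; lia.
pose oL : 'I_n := Ordinal (ltnW Ln); pose oP : 'I_n := Ordinal Ln.
have sIB (X : {set 'I_n}) : [set i in X | L <= i] = X :&: B by apply/setP =>
  i; rewrite !inE.
rewrite sIB in big *.
have cardB : #|B| = D.
  have -> : B = [set i : 'I_n | L <= i < n].
    by apply/setP => i; rewrite !inE ltn_ord andbT.
  by rewrite card_ord_interval // /L; lia.
(* Two vertices may have to be added to [S]; when there is room for only one, [S] already contains a
   leaf. *)
have [C [SC CB Ck [oLC [p pC Lp]]]] : exists C : {set 'I_n}, [/\ S \subset C,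
    C \subset S :|: B, #|C| <= k & oL \in C /\ exists2 p, p \in C & L < p].
  have add1 (X : {set 'I_n}) (i : 'I_n) : i \in B -> X \subset S :|: B ->
    i |: X \subset S :|: B.
    by move=> iB XB; rewrite subUset XB sub1set in_setU iB orbT.
  have card1 (X : {set 'I_n}) (i : 'I_n) : #|i |: X| <= #|X|.+1.
    by rewrite cardsU1; case: (_ \notin _).
  have oLB : oL \in B by rewrite inE /=.
  have oPB : oP \in B by rewrite inE /=.
  have SB : S \subset S :|: B by apply: subsetUl.
  case: (ltnP #|S|.+1 k) => [k2|k1].
    exists (oL |: (oP |: S)); split.
    - by rewrite setUA subsetUr.
    - by rewrite !add1.
    - exact: leq_trans (card1 _ _) (leq_ltn_trans (card1 _ _) k2).
    - by rewrite !inE eqxx; split => //; exists oP;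
      rewrite ?inE ?eqxx ?orbT //=.
  have {big} /card_gt0P[i /setIP[iS iB]] : 0 < #|S :&: B| by lia.
  case: (eqVneq i oL) => [iL|iL].
    exists (oP |: S); split; rewrite ?subsetUr ?add1 ?(leq_trans (card1 _ _))
      //.
    - by rewrite !inE -iL iS orbT; split => //; exists oP;
      rewrite ?inE ?eqxx //=.
  exists (oL |: S); split; rewrite ?subsetUr ?add1 ?(leq_trans (card1 _ _)) //.
  - rewrite !inE eqxx; split => //; exists i; rewrite ?inE ?iS ?orbT //.
    by move: iB iL; rewrite inE -val_eqE /=; lia.
have [S' [CS' kS' big']] : exists S' : {set 'I_n}, [/\ C \subset S', #|S'| = k &
    minn D (#|S :&: B| + (k - #|S|)) <= #|S' :&: B|].
  (* Either all the added vertices can be leaves, or all leaves fit into [S']. *)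
  case: (leqP k #|S :|: B|) => [kSB|kSB].
    have [|S' [CS' S'B cS']] := exists_set_between (k := k) CB;
      first by rewrite Ck.
    exists S'; split => //.
    have : #|S' :\: B| <= #|S :\: B|.
      apply/subset_leq_card/subsetP => i;
        rewrite !in_setD => /andP[iB /(subsetP S'B)].
      by rewrite in_setU (negPf iB) orbF.
    have := cardsID B S; have := cardsID B S'; rewrite cS';
      move: Sk #|S :&: B| #|S' :&: B| #|S :\: B| #|S' :\: B|.
    by move: #|S|; clear=> s; lia.
  have [|S' [CS' _ cS']] := exists_set_between (k := k) (subsetT (S :|: B)).
    by rewrite ltnW // cardsT card_ord.
  exists S'; split => //; first exact: subset_trans CB CS'.
  have BS' : B \subset S' by apply: subset_trans CS'; apply: subsetUr.
  by rewrite (setIidPr BS') cardB geq_minl.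
have st := broom_steiner_path (subsetP CS' _ oLC) (leqnn L) (subsetP CS' _ pC).
have {st} st := st 0; rewrite Lp orbT in st; have {}st := st isT.
have ec := ecc_ge (@broom n D) (subset_trans SC CS') kS'.
have : #|S' :&: B| <= 1 + #|[set i in S' | L < i]|.
  have sub : S' :&: B \subset oL |: [set i in S' | L < i].
    apply/subsetP => i; rewrite !inE -val_eqE /= => /andP[-> ]; lia.
  apply: leq_trans (subset_leq_card sub) _; rewrite cardsU1 leq_add2r.
  by case: (_ \notin _).
move: st ec big'; rewrite /= subn0;
  move: (ecc _ _ _) (steiner _ _) #|[set i in S' | _]|.
clear; lia.
Qed.

(** Adding the path's end [L] to [S] yields [L - m] edges, adding a pendant vertex yields [M + 1];
    the bound is the larger of the two. *)
Lemma broom_ecc_ge_path S m M : m \in S -> M \in S -> M < L ->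
  (forall i, i \in S -> i < L) ->
  L - minn m (L.-1 - M) <= ecc (@broom n D) #|S|.+1 S.
Proof.
move=> mS MS ML SL.
have Ln : L.+1 < n by rewrite /L; lia.
pose oL : 'I_n := Ordinal (ltnW Ln); pose oP : 'I_n := Ordinal Ln.
have add (i : 'I_n) : L <= i ->
  steiner (@broom n D) (i |: S) <= ecc (@broom n D) #|S|.+1 S.
  move=> Li; apply: ecc_ge; first exact: subsetUr.
  rewrite cardsU1 (_ : i \notin S) //; apply/negP => /SL; lia.
case: (leqP m (L.-1 - M)) => [mM|mM].
  apply: leq_trans (add oL (leqnn _)).
  apply: leq_trans (@broom_steiner_path _ oL m m _ _ _ _);
    rewrite ?leq_addr //= ?leqnn //.
  - by rewrite !inE eqxx.
  - by rewrite !inE mS orbT.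
apply: leq_trans (add oP (leqnSn _)).
have PS : oP \in oP |: S by rewrite !inE eqxx.
have MS' : M \in oP |: S by rewrite !inE MS orbT.
have P0 : (oP <= 0) || (L < oP) by rewrite /= ltnSn.
apply: leq_trans (broom_steiner_path MS' (ltnW ML) PS P0).
have : 0 < #|[set i in oP |: S | L < i]|.
  by apply/card_gt0P; exists oP; rewrite !inE eqxx /=.
by move: #|[set i in oP |: S | L < i]| ML mM; rewrite subn0; move: L; clear;
  lia.
Qed.

End Broom.

(** * Comparison of trees with brooms *)

Section SumsOverSubsets.
Variables (T : finType) (k : nat).
Implicit Types (X S : {set T}) (F : {set T} -> nat).

Lemma leq_sum_imset (U : finType) (X : {set U}) (Y : {set T}) (g : U -> T) F
    (G : {set U} -> nat) :
  {in X &, injective g} -> g @: X = Y ->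
  (forall S : {set U}, S \subset X -> #|S| = k -> F (g @: S) <= G S) ->
  \sum_(S : {set T} | (S \subset Y) && (#|S| == k)) F S <=
  \sum_(S : {set U} | (S \subset X) && (#|S| == k)) G S.
Proof.
move=> g_inj gX FG; pose A := [set S : {set U} | (S \subset X) && (#|S| == k)].
have sub (S S' : {set U}) : S \subset X -> S' \subset X ->
  g @: S = g @: S' -> S \subset S'.
  move=> SX SX' SS'; apply/subsetP => x xS.
  have /imsetP[x' xS' gx] : g x \in g @: S' by rewrite -SS' imset_f.
    by rewrite (g_inj x x' (subsetP SX _ xS) (subsetP SX' _ xS') gx).
have card_im (S : {set U}) : S \subset X -> #|g @: S| = #|S|.
  move=> SX; apply: card_in_imset => x y xS yS.
  exact: g_inj (subsetP SX _ xS) (subsetP SX _ yS).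
have im_inj : {in A &, injective (fun S : {set U} => g @: S)}.
  move=> S S'; rewrite !inE => /andP[SX _] /andP[SX' _] SS'.
  by apply/eqP; rewrite eqEsubset (sub S S') ?(sub S' S).
have -> : \sum_(S : {set T} | (S \subset Y) && (#|S| == k)) F S =
    \sum_(S in [set g @: (S : {set U}) | S in A]) F S.
  apply: eq_bigl => S; apply/andP/imsetP => [[SY cS]|[S' + ->]]; last first.
    by rewrite inE => /andP[SX cS]; rewrite -gX imsetS // card_im.
  have S_im : g @: (X :&: g @^-1: S) = S.
    apply/setP => y; apply/imsetP/idP => [[x + ->]|yS];
      first by rewrite !inE => /andP[].
    have : y \in g @: X by rewrite gX (subsetP SY).
    by case/imsetP=> x xX yx; exists x; rewrite // !inE xX -yx.
  by exists (X :&: g @^-1: S);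
    rewrite // inE subsetIl -card_im ?subsetIl // S_im.
rewrite (big_imset _ im_inj) /= (eq_bigl _ _ (in_set _)).
by apply: leq_sum => S /andP[SX /eqP]; apply: FG.
Qed.

(** Membership of [x] is a 0-1 factor, so that both sums have the index family that [leq_sum_imset]
    handles. *)
Lemma sum_subsets_split F X x : x \in X ->
  \sum_(S : {set T} | (S \subset X) && (#|S| == k)) F S =
  \sum_(S : {set T} | (S \subset X :\ x) && (#|S| == k)) F S +
  \sum_(S : {set T} | (S \subset X) && (#|S| == k)) (x \in S) * F S.
Proof.
move=> xX; rewrite (bigID (fun S : {set T} => x \notin S)) /=; congr (_ + _).
  by apply: eq_bigl => S; rewrite subsetD1 andbAC.
rewrite [RHS](bigID (fun S : {set T} =>
  x \notin S)) /= [X in _ = X + _]big1 ?add0n.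
  by apply: eq_bigr => S /andP[_ /negbNE->]; rewrite mul1n.
by move=> S /andP[_ /negPf->].
Qed.

End SumsOverSubsets.

(** * Laying out a vertex sequence on a broom with shortened path *)

Section Placement.
Variables (V : finType) (n D j : nat) (x0 : V) (u : seq V).
Hypotheses (D0 : 0 < D) (Dn : D < n) (jL : j <= n - D) (uu : uniq u) (su : size
  u = j + D).
Let L := n - D.

(* The part of the broom where its long branch is cut after vertex [j]. *)
Definition short_broom := [set i : 'I_n | (i <= j) || (L < i)].

(** Closes the gap left by the cut: the pendant vertices, from [L.+1] on, take the indices from
    [j.+1] on. *)
Definition place_index (i : 'I_n) : nat :=
  if i <= j then nat_of_ord i else i - (L - j).

Definition place i := nth x0 u (place_index i).

Lemma place_lt (i : 'I_n) : place_index i < size u.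
Proof.
rewrite su /place_index /L; move: (ltn_ord i) D0 Dn jL; clear.
by case: (leqP i j); lia.
Qed.

Lemma place_inj : {in short_broom &, injective place}.
Proof.
move=> a b; rewrite !inE => aX bX /eqP;
  rewrite nth_uniq ?place_lt // => /eqP ab.
apply: val_inj => /=; move: ab aX bX Dn jL; rewrite /place_index /L; clear.
by case: (leqP a j); case: (leqP b j); lia.
Qed.

Lemma place_img : place @: short_broom = [set y in u].
Proof.
apply/setP => y; rewrite inE; apply/imsetP/idP => [[i _ ->]|yu].
  by rewrite mem_nth ?place_lt.
have : index y u < j + D by rewrite -su index_mem.
set p := index y u => pu.
have iP : (if p <= j then p else p + (L - j)) < n.
  by rewrite /L; move: p pu D0 Dn jL; clear=> p; case: (leqP p j); lia.
exists (Ordinal iP); rewrite /place /place_index ?inE /=.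
  by rewrite /L; move: p pu D0 Dn jL {iP}; clear=> p; case: (leqP p j); lia.
rewrite -[LHS](nth_index x0 yu) -/p; congr nth.
rewrite /L; move: p pu D0 Dn jL {iP}; clear=> p.
by case: (leqP p j) => [->//|]; case: (leqP (p + _) j); lia.
Qed.

End Placement.

(** * Sums of Steiner distances, and the bijection for eccentricities *)

Section Comparison.
Variables (V : finType) (e : rel V) (n D : nat) (v : V).
Hypotheses (e_sym : symmetric e) (e_irr : irreflexive e) (e_acyc : acyclic e).
Hypotheses (D2 : 2 <= D) (Dn : D < n) (deg_v : degree e v = D).
Let L := n - D.
Let D0 : 0 < D := ltnW D2.

Lemma notin_nbrs : v \notin [set y | e v y].
Proof. by rewrite inE e_irr. Qed.

(** Base case of the induction: with [v] placed at 0, the tree needs at most one edge for each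
    vertex of [S] other than 0, and the broom needs all of these. *)
Lemma sum_steiner_star k : 2 <= k ->
  \sum_(S : {set V} | (S \subset v |: [set y | e v y]) && (#|S| == k)) steiner
    e S <=
  \sum_(S : {set 'I_n} | (S \subset short_broom n D 1) && (#|S| == k))
    steiner (@broom n D) S.
Proof.
move=> k2; pose u := v :: enum [set y | e v y].
have uu : uniq u by rewrite /= mem_enum notin_nbrs enum_uniq.
have su : size u = 1 + D by rewrite /= -cardE -deg_v.
have L1 : 1 <= n - D by rewrite subn_gt0.
have uE : [set y in u] = v |: [set y | e v y].
  by apply/setP => y; rewrite !inE mem_enum inE.
have g_img := place_img v D0 Dn L1 su.
apply: (leq_sum_imset (place_inj (x0 := v) D0 Dn L1 uu su) (etrans g_img uE)).
move=> S SX cS; apply: leq_trans (broom_steiner_star D2 Dn _ _); last 2 first.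
- by rewrite cS.
- by move=> i /(subsetP SX); rewrite inE.
pose W := v |: @place V n D 1 v u @: S.
have WN : W \subset v |: [set y | e v y].
  rewrite subUset sub1set !inE eqxx /= -uE -g_img.
  exact: imsetS.
have vW : v \in W by rewrite !inE eqxx.
have cW : conn e W.
  apply: (conn_star e_sym vW) => y /(subsetP WN).
  by rewrite !inE => /orP[->|].
apply: leq_trans (steiner_le e_sym e_acyc cW _ (subsetUr _ _)) _.
  by apply/set0Pn; exists v.
have sub : W \subset v |: @place V n D 1 v u @: [set i in S | 0 < i].
  rewrite subUset sub1set !inE eqxx /=; apply/subsetP => _ /imsetP[i iS ->].
  case: (posnP i) => [i0|i0]; last by rewrite in_setU imset_f ?orbT // inE iS.
  by rewrite /place /place_index i0 /= !inE eqxx.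
rewrite -ltnS prednK; last by apply/card_gt0P; exists v.
apply: leq_trans (subset_leq_card sub) _.
rewrite cardsU1; apply: leq_trans (leq_add (leq_b1 _) (leq_imset_card _ _)) _.
by rewrite add1n.
Qed.

Lemma sum_steiner_containing k j W x : j <= L -> conn e W -> #|W| = j + D ->
  v \in W -> [set y | e v y] \subset W -> x \in W ->
  forall oj : 'I_n, oj = j :> nat ->
  \sum_(S : {set V} | (S \subset W) && (#|S| == k)) (x \in S) * steiner e S <=
  \sum_(S : {set 'I_n} | (S \subset short_broom n D j) && (#|S| == k))
    (oj \in S) * steiner (@broom n D) S.
Proof.
move=> jL cW cardW vW nW xW oj ojE.
have [|L0 [L0W cardL0 leafL0]] := exists_leaves e_sym e_irr e_acyc cW vW nW.
  by rewrite deg_v.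
have [|Lam [_ LamL0 cardLam]] := exists_set_between (k := D.-1) (sub0set (L0 :\
  x)).
  rewrite cards0 /= -ltnS prednK // -deg_v -cardL0 (cardsD1 x L0).
  by case: (x \in L0); rewrite ?add1n ?add0n.
have xLam : x \notin Lam by apply/negP => /(subsetP LamL0); rewrite !inE eqxx.
have leafLam y : y \in Lam -> leaf e W y.
  by move=> /(subsetP LamL0)/setD1P[_]; apply: leafL0.
have LamW : Lam \subset W.
  apply/subsetP => y /(subsetP LamL0)/setD1P[_ /(subsetP L0W)].
  by case/setD1P.
have cQ : conn e (W :\: Lam) by apply: (conn_leaves e_sym cW).
have xQ : x \in W :\: Lam by rewrite inE xLam.
have [s [us sQ slast sdrop]] := grow_order e_sym cQ xQ.
have ss : size s = j.+1.
  rewrite -(card_uniqP us) (eq_card sQ) cardsD (setIidPr LamW) cardW cardLam.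
  by move: D0; clear; lia.
pose u := s ++ enum Lam.
have uu : uniq u.
  rewrite cat_uniq us enum_uniq andbT; apply/hasPn => y; rewrite mem_enum => yL.
  by rewrite /= sQ inE yL.
have su : size u = j + D by rewrite size_cat ss -cardE cardLam; move: D0;
  clear; lia.
have uW : [set y in u] = W.
  apply/setP => y; rewrite inE mem_cat mem_enum sQ inE.
  by case: (boolP (y \in Lam)) => [/(subsetP LamW)->|]; rewrite ?orbT ?orbF.
pose g := @place V n D j x u.
have g_inj : {in short_broom n D j &, injective g} by apply: place_inj.
have g_img : g @: short_broom n D j = W by rewrite -uW; apply: place_img.
have g_s (i : 'I_n) : i <= j -> g i = nth x s i.
  by move=> ij; rewrite /g /place /place_index ij nth_cat ss ltnS ij.
have ojX : oj \in short_broom n D j by rewrite inE ojE leqnn.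
have g_oj : g oj = x by rewrite g_s ?ojE // -[RHS]slast ss.
apply: (leq_sum_imset g_inj g_img) => S SX cS.
case: (boolP (x \in g @: S)) => //; rewrite -[in x \in _]g_oj.
case/imsetP=> i iS gi; have {gi} oji : oj = i by apply: g_inj => //;
  apply: (subsetP SX).
rewrite -oji {oji} in iS; rewrite iS !mul1n.
have gSW : g @: S \subset W by rewrite -g_img imsetS.
(* Without pendant vertices, [S] lies on the path between its least vertex [m] and [oj]; its image
   lies in a connected suffix of [s] with [j - m + 1] vertices. *)
have [S0|] := posnP #|[set i in S | L < i]|.
  have Sj i' : i' \in S -> i' <= j.
    move=> i'S; have := subsetP SX _ i'S; rewrite inE => /orP[//|i'L].
    by have := cards0_eq S0 => /setP/(_ i'); rewrite !inE i'S i'L.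
  case: (arg_minnP (fun i' : 'I_n => i' : nat) iS) => m mS m_min.
  have := @broom_steiner_path n D D2 Dn S oj m m iS _ mS _.
  rewrite leqnn ojE => /(_ jL isT); apply: leq_trans;
    apply: leq_trans (leq_addr _ _).
  have sub : g @: S \subset [set y in drop m s].
    apply/subsetP => _ /imsetP[i' i'S ->]; rewrite inE g_s ?Sj //.
    rewrite -{1}(subnKC (m_min _ i'S)) -nth_drop mem_nth // size_drop ss.
    by move: (Sj _ i'S) (m_min _ i'S); clear; lia.
  apply: leq_trans (steiner_le e_sym e_acyc (sdrop m) _ sub) _.
    apply/set0Pn; exists (g oj); apply: (subsetP sub); exact: imset_f.
  rewrite cardsE (card_uniqP (drop_uniq _ us)) size_drop ss.
  by move: (Sj _ mS); clear; lia.
case/card_gt0P=> p; rewrite inE => /andP[pS Lp].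
have := @broom_steiner_path n D D2 Dn S oj p 0 iS _ pS _.
rewrite ojE Lp orbT => /(_ jL isT); apply: leq_trans; rewrite subn0.
pose W' := W :\: (Lam :\: g @: S).
have cW' : conn e W'.
  by apply: (conn_leaves e_sym cW) => y /setDP[yL _]; apply: leafLam.
have sub : g @: S \subset W'.
  apply/subsetP => y yS; rewrite !inE yS /=; exact: (subsetP gSW).
apply: leq_trans (steiner_le e_sym e_acyc cW' _ sub) _.
  apply/set0Pn; exists (g oj); apply: (subsetP sub); exact: imset_f.
have cardI : #|Lam :&: g @: S| <= #|[set i in S | L < i]|.
  apply: leq_trans (leq_imset_card g _); apply/subset_leq_card/subsetP => y.
  rewrite inE => /andP[yL /imsetP[i' iS' yi]]; rewrite yi in yL *.
  apply: imset_f; rewrite inE iS' /=; have := subsetP SX _ iS'.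
  rewrite inE => /orP[ij|//]; move: yL; rewrite g_s //.
  have : nth x s i' \in s by rewrite mem_nth // ss ltnS.
  by rewrite sQ inE => /andP[/negPf->].
rewrite /W' cardsD (setIidPr (subset_trans (subsetDl _ _) LamW)) cardsD cardW
  cardLam.
apply: leq_trans (leq_add (leqnn j) cardI).
by move: #|Lam :&: g @: S| D0; clear; lia.
Qed.

Lemma sum_steiner_le k j W : 2 <= k -> 0 < j <= L -> conn e W ->
  #|W| = j + D -> v \in W -> [set y | e v y] \subset W ->
  \sum_(S : {set V} | (S \subset W) && (#|S| == k)) steiner e S <=
  \sum_(S : {set 'I_n} | (S \subset short_broom n D j) && (#|S| == k))
    steiner (@broom n D) S.
Proof.
move=> k2; elim: j W => [//|j IHj] W /= jL cW cardW vW nW.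
pose A := v |: [set y | e v y].
have cardA : #|A| = 1 + D by rewrite cardsU1 notin_nbrs -deg_v.
have AW : A \subset W by rewrite subUset sub1set vW.
case: j IHj jL cardW => [|j] IHj jL cardW.
  have <- : A = W by apply/eqP; rewrite eqEcard AW cardW cardA leqnn.
  exact: sum_steiner_star.
have cA : conn e A.
  apply: (@conn_star _ _ e_sym A v) => [|y]; first by rewrite !inE eqxx.
  by rewrite !inE => /orP[->|].
have [||x /setDP[xW]] := @conn_remove _ _ e_sym A W cA cW.
- by apply/set0Pn; exists v; rewrite !inE eqxx.
- by rewrite properEcard AW cardA cardW; move: D0; clear; lia.
rewrite !inE negb_or => /andP[xv nevx] cWx.
have jn : j.+2 < n by move: jL Dn D0; rewrite /L; clear; lia.
have jX : Ordinal jn \in short_broom n D j.+2 by rewrite inE /= leqnn.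
(* The sets avoiding [x] are matched with those avoiding the last path vertex, whose loss shortens
   the path by one. *)
rewrite (sum_subsets_split k _ xW) (sum_subsets_split k _ jX); apply: leq_add.
  have -> : short_broom n D j.+2 :\ Ordinal jn = short_broom n D j.+1.
    apply/setP => i; rewrite !inE -val_eqE /=.
    by move: (nat_of_ord i) jL; rewrite /L; clear; lia.
  apply: IHj => //.
  - exact: ltnW.
  - by move: cardW; rewrite (cardsD1 x W) xW; case.
  - by rewrite !inE eq_sym xv.
  - apply/subsetP => y yN; rewrite !inE (subsetP nW) // andbT.
    by apply: contraNneq nevx => <-; move: yN; rewrite inE.
exact: sum_steiner_containing.
Qed.

Hypotheses (cT : conn e [set: V]) (cardV : #|V| = n).

Lemma ecc_le_broom_bij : exists g : 'I_n -> V, injective g /\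
  forall k (S : {set 'I_n}), 2 <= k -> #|S| < k <= n ->
    ecc e k (g @: S) <= ecc (@broom n D) k S.
Proof.
have [|Lam [LamT cardLam leafLam]] :=
    exists_leaves e_sym e_irr e_acyc cT (in_setT v) (subsetT _).
  by rewrite deg_v.
rewrite deg_v in cardLam.
pose Q := [set: V] :\: Lam.
have QE y : (y \in Q) = (y \notin Lam) by rewrite !inE andbT.
have conn_del (X : {set V}) : X \subset Lam -> conn e ([set: V] :\: X).
  by move=> XL; apply: (conn_leaves e_sym cT) => y /(subsetP XL)/leafLam.
have cQ : conn e Q by apply: conn_del.
have vQ : v \in Q.
  by rewrite QE; apply/negP => /(subsetP LamT); rewrite !inE eqxx.
have cardQ : #|Q| = L.
  by rewrite cardsD (setIidPr (subsetT _)) cardsT cardV cardLam.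
have [s [us sQ win]] := peel_order e_sym e_irr e_acyc cQ.
have ss : size s = L by rewrite -(card_uniqP us) (eq_card sQ).
(* The peeling order fills positions below [L]; one chosen leaf then sits at the path's end and the
   others are pendant. *)
pose u := s ++ enum Lam.
have uu : uniq u.
  rewrite cat_uniq us enum_uniq andbT; apply/hasPn => y; rewrite mem_enum => yL.
  by rewrite /= sQ QE yL.
have su : size u = n.
  by rewrite size_cat ss -cardE cardLam subnK // ltnW.
pose g (i : 'I_n) := nth v u i.
have g_inj : injective g.
  move=> a b /eqP; rewrite nth_uniq ?su // => /eqP; exact: val_inj.
have g_s (i : 'I_n) : i < L -> g i = nth v s i.
  by move=> iL; rewrite /g nth_cat ss iL.
exists g; split => // k S k2 Skn; have /andP[Sk kn] := Skn.
have cardgS : #|g @: S| = #|S| by apply: card_imset.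
have n0 : 0 < n by apply: leq_trans Dn.
case: (boolP ((0 < #|[set i in S | L <= i]|) || (#|S|.+1 < k))) => [big|].
  have := broom_ecc_ge_leaves D2 Dn Skn big.
  set s0 := #|[set i in S | _]| => ge_ecc.
  (* [S'] contains at most [s0 + (k - #|S|)] of the [D] leaves in [Lam], and the missed ones can be
     deleted. The truncated subtraction matches the [minn] in the bound for the broom. *)
  suff le_ecc : ecc e k (g @: S) <= n.-1 - (D - (s0 + (k - #|S|))).
    by apply: leq_trans le_ecc _; move: ge_ecc Dn; move: (s0 + _) (ecc _ _ _);
      clear; lia.
  apply: ecc_le => S' gSS' cS'.
  have sub : S' \subset [set: V] :\: (Lam :\: S').
    by apply/subsetP => y yS'; rewrite !inE yS'.
  apply: leq_trans (steiner_le e_sym e_acyc (conn_del _ (subsetDl _ _)) _ sub)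
    _.
    by apply/set0Pn; exists v; move: vQ; rewrite QE !inE => /negPf->;
      rewrite andbF.
  rewrite cardsD (setIidPr (subsetT _)) cardsT cardV cardsD cardLam.
  have cardI : #|Lam :&: g @: S| <= s0.
    apply: leq_trans (leq_imset_card g _); apply/subset_leq_card/subsetP => y.
    rewrite inE => /andP[yL /imsetP[i iS yi]]; rewrite yi in yL *.
    apply: imset_f; rewrite inE iS /= leqNgt; apply/negP => iL.
    have : nth v s i \in s by rewrite mem_nth // ss.
    by rewrite sQ QE -g_s // yL.
  have cardI' : #|Lam :&: S'| <= #|Lam :&: g @: S| + #|S' :\: g @: S|.
    apply: leq_trans (leq_card_setU _ _); apply/subset_leq_card/subsetP => y.
    by rewrite !inE => /andP[-> ->]; rewrite andbT orbN.
  have : #|S' :\: g @: S| = k - #|S| by rewrite cardsD (setIidPr gSS') cS'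
    cardgS.
  move=> cD; rewrite cD in cardI'.
  have {cardI cardI'} := leq_trans cardI' (leq_add cardI (leqnn _)).
  by move: #|Lam :&: S'| (s0 + _); clear; lia.
rewrite negb_or -eqn0Ngt cards_eq0 -leqNgt => /andP[/eqP S0 kS].
have {kS Sk kn Skn} kE : k = #|S|.+1 by apply/eqP; rewrite eqn_leq kS.
rewrite {}kE in k2 *.
have SL i : i \in S -> i < L.
  by move=> iS; have /setP/(_ i) := S0; rewrite !inE iS ltnNge => /= ->.
have /card_gt0P[i0 i0S] : 0 < #|S| by [].
case: (arg_minnP (fun i : 'I_n => i : nat) i0S) => m mS m_min.
case: (arg_maxnP (fun i : 'I_n => i : nat) i0S) => M MS M_max.
apply: leq_trans (broom_ecc_ge_path D2 Dn mS MS (SL M MS) SL).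
(* The largest [j] for which the positions in [S] all lie in the window. *)
set j := minn m _.
have jm : j <= m by apply: geq_minl.
have jM : j <= L.-1 - M by apply: geq_minr.
have ML := SL M MS.
have mM := m_min M MS.
have [|cw dw] := win j; first by rewrite ss -addnn; move: jm jM ML mM; clear;
  lia.
have gS_win : g @: S \subset window s j.
  apply/subsetP => _ /imsetP[i iS ->]; rewrite g_s ?SL // inE.
  have ji : j <= i by apply: leq_trans (m_min i iS).
  have iLj : i < L - j by move: (M_max i iS) jM ML; clear; lia.
  rewrite -(nth_take v (n0 := size s - j)) ?ss //.
  rewrite -{1}(subnKC ji) -nth_drop mem_nth // size_drop size_takel ?ss
    ?leq_subr //.
  by move: iLj ji; clear; lia.
have card_win : #|window s j| = L - j - j.
  by rewrite cardsE (card_uniqP _) ?drop_uniq ?take_uniq // size_drop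
    size_takel ss // leq_subr.
(* A leaf in [Lam] costs one vertex more than its neighbour in [Q]. Since [E] meets the window,
   their union has at most [(j + 2) + (L - 2j) - 1] vertices, hence a spanning tree with at most
   [L - j] edges. *)
have near y : exists E, [/\ conn e E, y \in E,
  E :&: window s j != set0 & #|E| <= j.+2].
  have [yL|yQ] := boolP (y \in Lam); last first.
    have [|E [cE yE nE cardE]] := dw y; first by rewrite QE.
    by exists E; split => //; apply: ltnW.
  (* Deleting the other leaves keeps [y] connected to the rest, so its neighbour there lies in
     [Q]. *)
  pose W := [set: V] :\: (Lam :\ y).
  have cW : conn e W by apply/conn_del/subsetDl.
  have yW : y \in W by rewrite !inE eqxx.
  have W1 : 1 < #|W|.
    rewrite (cardsD1 y) yW ltnS; apply/card_gt0P; exists v.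
    by move: vQ; rewrite QE !inE => vL; rewrite (negPf vL) andbF !andbT;
      apply: contraNneq vL => ->.
  have [b] := conn_nbr cW yW W1; rewrite !inE andbT => /andP[yb].
  rewrite yb /= => bL eyb.
  have [|E [cE bE nE cardE]] := dw b; first by rewrite QE.
  exists (y |: E); split.
  - by apply: conn_add bE _ => //; rewrite e_sym.
  - by rewrite !inE eqxx.
  - by apply: contraNN nE; rewrite -!subset0 => /(subset_trans _); apply;
    apply/setSI/subsetUr.
  - by rewrite cardsU1; case: (_ \notin _); rewrite ?add1n ?add0n // ltnW.
apply: ecc_le => S' gSS' cS'.
have /card_gt0P[y yS'] : 0 < #|S' :\: g @: S|.
  by rewrite cardsD (setIidPr gSS') cS' cardgS subSnn.
have S'E : S' = y |: g @: S.
  apply/esym/eqP; rewrite eqEcard subUset sub1set gSS' cS' cardsU1 cardgS.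
  by case/setDP: yS' => -> ->; rewrite add1n leqnn.
have [E [cE yE nE cardE]] := near y.
have cU := conn_setU cE cw nE.
have sub : S' \subset E :|: window s j.
  by rewrite S'E subUset sub1set inE yE /= (subset_trans gS_win) // subsetUr.
apply: leq_trans (steiner_le e_sym e_acyc cU _ sub) _.
  by apply/set0Pn; exists y; rewrite inE yE.
have : 0 < #|E :&: window s j| by rewrite card_gt0.
rewrite cardsU card_win; move: cardE jm jM ML mM; clear; lia.
Qed.

End Comparison.

Theorem theorem7 (V : finType) (e : rel V) (n k l Delta : nat)
  (hk : 2 <= k) (hlk : l <= k) (hkn : k <= n)
  (hn : #|V| = n)
  (he : simple_graph e) (htree : is_tree [set: V] e)
  (hDelta : max_degree e = Delta) (hDelta2 : 2 <= Delta) :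
  (avg_ecc e k l <= avg_ecc (@broom n Delta) k l)%R.
Proof.
case: he => e_sym e_irr.
have e_acyc : acyclic e by case/and3P: htree.
have cT := conn_tree e_sym htree.
have V0 : 0 < #|V| by rewrite hn; apply: leq_trans hkn; apply: ltnW.
have [v deg_v] : exists v, degree e v = Delta.
  by have [v vE] := eq_bigmax (degree e) V0; exists v; rewrite -vE.
have Dn : Delta < n.
  have := max_card (mem (v |: [set y | e v y])).
  by rewrite cardsU1 inE e_irr hn -deg_v.
rewrite /avg_ecc card_ord hn; apply: Num.Theory.ler_wpM2l.
  by rewrite Num.Theory.invr_ge0 Num.Theory.ler0n.
rewrite Num.Theory.ler_nat.
have subT (T : finType) (F : {set T} ->
  nat) : \sum_(S : {set T} | #|S| == l) F S =
    \sum_(S : {set T} | (S \subset [set: T]) && (#|S| == l)) F S.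
  by apply: eq_bigl => S; rewrite subsetT.
rewrite !subT.
(* For [l < k] one bijection compares the sums term by term; for [l = k] the eccentricity is the
   Steiner distance of [S] itself. *)
have [kl|lk] := leqP k l; last first.
  have [g [g_inj le_g]] := ecc_le_broom_bij e_sym e_irr e_acyc hDelta2 Dn deg_v
    cT hn.
  apply: (leq_sum_imset (g := g)) => [x y _ _|| S _ cS]; first exact: g_inj.
    apply/eqP; rewrite eqEcard subsetT cardsT card_imset // cardsT card_ord hn.
    by rewrite leqnn.
  by apply: le_g; rewrite // cS lk.
have {kl hlk} kl : l = k by apply/eqP; rewrite eqn_leq hlk.
subst l.
have eccE (T : finType) (f : rel T) :
    \sum_(S : {set T} | (S \subset [set: T]) && (#|S| == k)) ecc f k S =
    \sum_(S : {set T} | (S \subset [set: T]) && (#|S| == k)) steiner f S.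
  by apply: eq_bigr => S /andP[_ /eqP <-]; rewrite ecc_card.
rewrite !eccE.
(* Cutting the path after its last vertex removes nothing. *)
have -> : [set: 'I_n] = short_broom n Delta (n - Delta).
  by apply/esym/setP => i; rewrite !inE ltnNge orbN.
apply: (sum_steiner_le e_sym e_irr e_acyc hDelta2 Dn deg_v hk) => //.
- by rewrite subn_gt0 Dn leqnn.
- by rewrite cardsT hn subnK // ltnW.
Qed.
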